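(* There exists an absolute constant $c>0$ such that the following holds. Let $r$ be a positive integer and let $M\in\{0,1\}^{n\times n}$ with $\operatorname{rank}(M)\leq r$ and $p(M)\leq 1/2$. Then $z(M)\geq n/2^{c\sqrt r}$.
   Context: $p(M)=|M|/n^2$, where $|M|$ is the number of $1$ entries. $z(M)$ is the largest $z$ for which there exist $X,Y\subset[n]$ with $|X|=|Y|=z$ such that the submatrix $M[X\times Y]$ (rows $X$, columns $Y$) has only $0$ entries. *)

(* Defs.v *)
From mathcomp Require Import all_boot all_order all_algebra.
From Stdlib Require Import Reals.
Set Implicit Arguments. Unset Strict Implicit. Unset Printing Implicit Defensive.

Definition ones (n : nat) (M : 'M[bool]_n) : nat :=
  #|[set ij : 'I_n * 'I_n | M ij.1 ij.2]|.

(* rank of M as a 0/1 matrix over the rationals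
   (equal to its rank over the reals) *)
Definition bool_rank (n : nat) (M : 'M[bool]_n) : nat :=
  \rank (map_mx (fun b : bool => (b : nat)%:R : rat) M).

Definition zero_rect (n : nat) (M : 'M[bool]_n) (X Y : {set 'I_n}) : bool :=
  [forall i in X, forall j in Y, ~~ M i j].

Definition zM (n : nat) (M : 'M[bool]_n) : nat :=
  \max_(k < n.+1 | [exists X : {set 'I_n}, exists Y : {set 'I_n},
        [&& #|X| == k, #|Y| == k & zero_rect M X Y]]) k.

(* Main.v *)
Require Import Defs.
From mathcomp Require Import all_boot all_order all_algebra.
From mathcomp Require Import ring lra zify realalg.
Set Implicit Arguments. Unset Strict Implicit. Unset Printing Implicit Defensive.
Import Order.TTheory GRing.Theory Num.Theory.
Local Open Scope ring_scope.

(* Let P be the orthogonal projection onto the column space of an N x N matrix M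
   of rank r with density p. As M = P M, the entry M i j is the inner product of
   row i of P with column j of M; the squared norms of the rows sum to r, those
   of the columns to p N^2. Hence on half of the rows and half of the columns M
   is a matrix of inner products of vectors whose norms multiply to at most
   D = 2 sqrt (p r). If D < 1, this submatrix vanishes. Otherwise Grothendieck's
   inequality, applied to M - q with q slightly less than p, yields a k x k
   submatrix of density at most q = p - c p / D, with k = N %/ 4. Descending
   from density p to p / 4 takes O(D) such steps, and the costs form a geometric
   series with sum O(sqrt r). *)

(** * Orthogonal projections over an ordered field *)

Lemma mul_row_tr_eq0 (K : realFieldType) n (v : 'rV[K]_n) :
  v *m v^T = 0 -> v = 0.
Proof.
move/matrixP/(_ 0 0); rewrite !mxE => vv0.
have /psumr_eq0P v0 : forall k, true -> 0 <= v 0 k * v^T k 0.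
  by move=> k _; rewrite mxE -expr2 sqr_ge0.
apply/rowP => k; rewrite mxE.
by have := v0 vv0 k isT; rewrite mxE -expr2 => /eqP; rewrite sqrf_eq0 => /eqP.
Qed.

(** If v B B^T = 0 then (v B)(v B)^T = 0, a sum of squares, so v B = 0 and v = 0 by row-freeness. *)
Lemma gram_unitmx (K : realFieldType) m n (B : 'M[K]_(m, n)) :
  row_free B -> B *m B^T \in unitmx.
Proof.
move=> Bfree; rewrite -row_free_unit; apply/row_freeP.
have: kermx (B *m B^T) = 0.
  apply/row_matrixP => i; rewrite row0.
  set v := row i _.
  have v0 : v *m (B *m B^T) = 0 by rewrite /v -row_mul mulmx_ker row0.
  have: (v *m B) *m (v *m B)^T = 0.
    by rewrite trmx_mul mulmxA -(mulmxA v) v0 mul0mx.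
  by move/mul_row_tr_eq0 => vB0; apply: (row_free_inj Bfree); rewrite vB0 mul0mx.
by move/eqP; rewrite kermx_eq0 => /row_freeP.
Qed.

(** For a column basis C of A take P = C (C^T C)^-1 C^T; by cyclicity its trace is that of an
    identity matrix of size rank A. *)
Lemma ortho_proj (K : realFieldType) m n (A : 'M[K]_(m, n)) :
  exists P : 'M[K]_m,
    [/\ P^T = P, P *m P = P, P *m A = A & \tr P = (\rank A)%:R].
Proof.
have [C [D [defA Cfree]]] :
    exists (C : 'M_(m, \rank A)) D, A = C *m D /\ row_free C^T.
  exists (col_base A), (row_base A); rewrite mulmx_base; split=> //.
  by rewrite /row_free mxrank_tr; exact: col_base_full.
set G := C^T *m C.
have Gu : G \in unitmx by have := gram_unitmx Cfree; rewrite trmxK.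
have GT : G^T = G by rewrite /G trmx_mul trmxK.
exists (C *m invmx G *m C^T); split.
- by rewrite !trmx_mul trmxK trmx_inv GT mulmxA.
- by rewrite !mulmxA -(mulmxA _ C^T C) -/G mulmxKV.
- by rewrite [X in _ *m X]defA !mulmxA -(mulmxA _ C^T C) -/G mulmxKV.
- by rewrite mxtrace_mulC mulmxA -/G mulmxV // mxtrace1.
Qed.

(** * Rademacher sums and their second and fourth moments *)

(* That the sample space has square cardinality avoids square roots when its
   uniform measure is normalized. *)
Lemma rademacher (K : realFieldType) d :
  exists (T : finType) (e : T -> 'I_d -> K) (m : nat),
    [/\ (0 < m)%N, #|T| = (m * m)%N,
     forall x y : 'I_d -> K,
       \sum_t (\sum_k e t k * x k) * (\sum_k e t k * y k)
         = #|T|%:R * \sum_k x k * y k &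
     forall x : 'I_d -> K,
       \sum_t (\sum_k e t k * x k) ^+ 4
         <= 3 * #|T|%:R * (\sum_k x k ^+ 2) ^+ 2].
Proof.
elim: d => [|d [T [e [m [m0 Tm e2 e4]]]]].
  exists unit, (fun _ _ => 0), 1%N; split=> [||x y|x] //.
  - by rewrite card_unit.
  - by rewrite big1 ?big_ord0 ?mulr0 // => t _; rewrite big_ord0 mul0r.
  - by rewrite big1 ?big_ord0 ?expr0n ?mulr0 // => t _; rewrite big_ord0 expr0n.
pose s (b : bool) : K := (-1) ^+ b.
(* Only the first bit serves as the new sign. The second just doubles the space again, so that its
   cardinality stays a square. *)
pose e' (t : (bool * bool) * T) (k : 'I_d.+1) : K :=
  if unlift 0 k is Some j then e t.2 j else s t.1.1.
have sumT (f : (bool * bool) * T -> K) :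
    \sum_t f t = \sum_t (f ((true, true), t) + f ((true, false), t)
                         + f ((false, true), t) + f ((false, false), t)).
  have -> : \sum_t f t = \sum_b \sum_t f (b, t).
    by rewrite pair_bigA; apply: eq_bigr => -[b t].
  have -> : \sum_b \sum_t f (b, t) = \sum_b \sum_c \sum_t f ((b, c), t).
    by rewrite [RHS]pair_bigA; apply: eq_bigr => -[b t].
  rewrite !big_bool /= -!big_split /=.
  by apply: eq_bigr => t _; rewrite !addrA.
have sume b t (x : 'I_d.+1 -> K) : \sum_k e' (b, t) k * x k
    = s b.1 * x 0 + \sum_k e t k * x (lift 0 k).
  rewrite big_ord_recl /e' unlift_none /=; congr (_ + _).
  by apply: eq_bigr => k _; rewrite liftK.
exists ((bool * bool) * T)%type, e', (2 * m)%N; split.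
- by rewrite muln_gt0.
- by rewrite !card_prod card_bool Tm; lia.
- move=> x y; rewrite sumT big_ord_recl /=.
  pose X t := \sum_k e t k * x (lift 0 k); pose Y t := \sum_k e t k * y (lift 0 k).
  rewrite (eq_bigr (fun t => 4 * (x 0 * y 0) + 4 * (X t * Y t))); last first.
    by move=> t _; rewrite !sume /s /= -/(X t) -/(Y t); ring.
  rewrite big_split /= sumr_const -mulr_sumr e2 -mulr_natl.
  by rewrite !card_prod card_bool natrM; ring.
- move=> x; rewrite sumT big_ord_recl /=.
  pose X t := \sum_k e t k * x (lift 0 k).
  rewrite (eq_bigr (fun t =>
    4 * x 0 ^+ 4 + 24 * x 0 ^+ 2 * (X t * X t) + 4 * X t ^+ 4)); last first.
    by move=> t _; rewrite !sume /s /= -/(X t); ring.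
  rewrite !big_split /= sumr_const -!mulr_sumr e2 -[_ *+ #|_|]mulr_natl.
  rewrite !card_prod card_bool natrM.
  have -> : \sum_(k < d) x (lift 0 k) * x (lift 0 k) = \sum_k x (lift 0 k) ^+ 2.
    by apply: eq_bigr => k _; rewrite expr2.
  have := e4 (fun k => x (lift 0 k)); rewrite -/X.
  have : 0 <= (#|T|%:R : K) * x 0 ^+ 4.
    by rewrite mulr_ge0 ?ler0n // (exprM _ 2 2) sqr_ge0.
  rewrite -/(\sum_t X t ^+ 4).
  set F := \sum_t _ ^+ 4; set N := #|T|%:R; set Q := \sum_k _ => h0 hF.
  have -> : (2 * 2)%:R = 4 :> K by [].
  (* The terms in Q match the moment computed above exactly; the slack is 8 N (x 0)^4. *)
  have -> : 3 * (4 * N) * (x ord0 ^+ 2 + Q) ^+ 2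
    = 12 * (N * x 0 ^+ 4) + 24 * x 0 ^+ 2 * (N * Q) + 4 * (3 * N * Q ^+ 2) by ring.
  lra.
Qed.

Lemma rademacher_fin (K : realFieldType) (D : finType) :
  exists (T : finType) (e : T -> D -> K) (m : nat),
    [/\ (0 < m)%N, #|T| = (m * m)%N,
     forall x y : D -> K,
       \sum_t (\sum_k e t k * x k) * (\sum_k e t k * y k)
         = #|T|%:R * \sum_k x k * y k &
     forall x : D -> K,
       \sum_t (\sum_k e t k * x k) ^+ 4
         <= 3 * #|T|%:R * (\sum_k x k ^+ 2) ^+ 2].
Proof.
have [T [e [m [m0 Tm e2 e4]]]] := rademacher K #|D|.
have sumD (f : D -> K) : \sum_k f k = \sum_(i < #|D|) f (enum_val i).
  by rewrite (reindex _ (onW_bij _ (@enum_val_bij D))).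
have sume t x : \sum_k e t (enum_rank k) * x k
    = \sum_(i < #|D|) e t i * x (enum_val i).
  by rewrite sumD; apply: eq_bigr => i _; rewrite enum_valK.
exists T, (fun t k => e t (enum_rank k)), m; split=> // [x y|x].
  by rewrite sumD -e2; apply: eq_bigr => t _; rewrite !sume.
rewrite sumD; apply: le_trans (e4 _).
by under eq_bigr do rewrite sume.
Qed.

(** * Grothendieck's inequality by truncation *)

Definition truncate (K : realFieldType) (x : K) := Num.max (-2) (Num.min 2 x).

(** Past the cutoff write |x| = z + 2: squaring (z + 2)^2 >= 8 z gives the last bound, by which a
    fourth moment controls the second moment of the tail. *)
Lemma truncate_bound (K : realFieldType) (x : K) :
  [/\ `|truncate x| <= 2, truncate x ^+ 2 <= x ^+ 2 &
      64 * (x - truncate x) ^+ 2 <= x ^+ 4].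
Proof.
have aux (z : K) : 0 <= z -> 64 * z ^+ 2 <= (z + 2) ^+ 4.
  move=> z0; have -> : 64 * z ^+ 2 = (8 * z) ^+ 2 by ring.
  have z8 : 0 <= 8 * z by lra.
  rewrite (exprM _ 2 2) ler_sqr ?nnegrE ?sqr_ge0 //.
  by have := sqr_ge0 (z - 2); lra.
rewrite /truncate; have [x2|x2] := leP 2 x.
  rewrite max_r ?ger0_norm; [|lra..].
  split=> //; last by have := aux (x - 2); rewrite subrK; apply; rewrite subr_ge0.
  by rewrite ler_sqr ?nnegrE //; lra.
have [x3|x3] := leP (-2) x.
  split=> //; first by rewrite ler_norml; lra.
  by rewrite subrr expr0n /= mulr0 (exprM _ 2 2) sqr_ge0.
split; first by rewrite normrN ger0_norm.
  by nra.
have -> : (x - -2) ^+ 2 = (- x - 2) ^+ 2 by ring.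
have -> : x ^+ 4 = (- x - 2 + 2) ^+ 4 by ring.
by apply: aux; lra.
Qed.

(** The vector relaxation of the bilinear maximum over signs, with unit balls of every finite
    dimension. *)
Definition vector_bound (K : realFieldType) (I J : finType) (F : I -> J -> K)
    (B : K) : Prop :=
  forall (T : finType) (u : I -> T -> K) (v : J -> T -> K),
    (forall i, \sum_t u i t ^+ 2 <= 1) -> (forall j, \sum_t v j t ^+ 2 <= 1) ->
    \sum_i \sum_j F i j * (\sum_t u i t * v j t) <= B.

(* Replace each vector by the corresponding Rademacher sum and truncate it at
   height 2: the truncated parts are controlled by S, and the tails, being
   vectors of norm at most 1/4 by the fourth moment bound, by B again. *)
Lemma vector_bound_step (K : realFieldType) (I J : finType) (F : I -> J -> K)
    (S B : K) :
  (forall x y, (forall i, `|x i| <= 1) -> (forall j, `|y j| <= 1) ->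
     \sum_i \sum_j F i j * (x i * y j) <= S) ->
  vector_bound F B -> vector_bound F (4 * S + B / 2).
Proof.
move=> FS FB D u v u1 v1.
have [T [e [m [m0 Tm e2 e4]]]] := rademacher_fin K D.
pose X i t := \sum_k e t k * u i k; pose Y j t := \sum_k e t k * v j k.
set N : K := #|T|%:R in e2 e4.
have mN : m%:R ^+ 2 = N by rewrite /N Tm natrM expr2.
have m0' : 0 < m%:R :> K by rewrite ltr0n.
have N0 : 0 < N by rewrite -mN exprn_gt0.
have X2 i : \sum_t X i t ^+ 2 <= N.
  under eq_bigr do rewrite expr2.
  rewrite e2 -[leRHS]mulr1 ler_pM2l //.
  by under eq_bigr do rewrite -expr2.
have Y2 j : \sum_t Y j t ^+ 2 <= N.
  under eq_bigr do rewrite expr2.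
  rewrite e2 -[leRHS]mulr1 ler_pM2l //.
  by under eq_bigr do rewrite -expr2.
(* The factors 64 of [truncate_bound] and 3 of the fourth moment leave at most 3 N / 64 <= N /
   16. *)
have tail (w : D -> K) : \sum_k w k ^+ 2 <= 1 ->
    16 * \sum_t ((\sum_k e t k * w k) - truncate (\sum_k e t k * w k)) ^+ 2 <= N.
  move=> w1; have w2 : (\sum_k w k ^+ 2) ^+ 2 <= 1.
    by rewrite expr_le1 // sumr_ge0 // => k _; rewrite sqr_ge0.
  have := e4 w; have : 64 * \sum_t ((\sum_k e t k * w k) - truncate (\sum_k e t k * w k)) ^+ 2
     <= \sum_t (\sum_k e t k * w k) ^+ 4.
    by rewrite mulr_sumr ler_sum // => t _; case: (truncate_bound (\sum_k e t k * w k)).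
  have : N * (\sum_k w k ^+ 2) ^+ 2 <= N by rewrite ger_pMr.
  lra.
(* The bound [B] is applied to the vectors c / m * U i and c' / m * V j over the sample space, where
   m^2 = N. *)
have scaled (U : I -> T -> K) (V : J -> T -> K) (c c' : K) :
    0 < c -> 0 < c' ->
    (forall i, c ^+ 2 * \sum_t U i t ^+ 2 <= N) ->
    (forall j, c' ^+ 2 * \sum_t V j t ^+ 2 <= N) ->
    c * c' * \sum_i \sum_j F i j * (\sum_t U i t * V j t) <= N * B.
  move=> c0 c'0 UN VN.
  have sq (f : T -> K) b : \sum_t (b / m%:R * f t) ^+ 2 = N^-1 * (b ^+ 2 * \sum_t f t ^+ 2).
    rewrite !mulr_sumr; apply: eq_bigr => t _.
    by rewrite -mN; field; rewrite lt0r_neq0.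
  rewrite -ler_pdivrMl //.
  apply: le_trans (FB T (fun i t => c / m%:R * U i t) (fun j t => c' / m%:R * V j t) _ _).
  - rewrite le_eqVlt; apply/orP; left; apply/eqP.
    rewrite !mulr_sumr; apply: eq_bigr => i _.
    rewrite !mulr_sumr; apply: eq_bigr => j _.
    rewrite !mulr_sumr; apply: eq_bigr => t _.
    by rewrite -mN; field; rewrite lt0r_neq0.
  - by move=> i; rewrite sq ler_pdivrMl // mulr1.
  - by move=> j; rewrite sq ler_pdivrMl // mulr1.
pose tX i t := truncate (X i t); pose tY j t := truncate (Y j t).
have bulk : \sum_i \sum_j F i j * (\sum_t tX i t * tY j t) <= N * (4 * S).
  have -> : \sum_i \sum_j F i j * (\sum_t tX i t * tY j t)
      = \sum_t 4 * \sum_i \sum_j F i j * (tX i t / 2 * (tY j t / 2)).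
    rewrite -mulr_sumr [in RHS]exchange_big /= mulr_sumr; apply: eq_bigr => i _.
    rewrite [in RHS]exchange_big /= mulr_sumr; apply: eq_bigr => j _.
    by rewrite !mulr_sumr; apply: eq_bigr => t _; field.
  rewrite /N mulr_natl -sumr_const; apply: ler_sum => t _.
  have half (z : K) : `|z| <= 2 -> `|z / 2| <= 1.
    by rewrite normf_div [`|2|]gtr0_norm // ler_pdivrMr // mul1r.
  rewrite ler_pM2l //; apply: FS => k; apply: half.
    by case: (truncate_bound (X k t)).
  by case: (truncate_bound (Y k t)).
have tail1 : 4 * 1 * \sum_i \sum_j F i j * (\sum_t (X i t - tX i t) * Y j t) <= N * B.
  apply: scaled => // [i|j]; last by rewrite expr1n mul1r.
  by have := tail _ (u1 i); rewrite -/(X i _); lra.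
have tail2 : 1 * 4 * \sum_i \sum_j F i j * (\sum_t tX i t * (Y j t - tY j t)) <= N * B.
  apply: scaled => // [i|j]; last by have := tail _ (v1 j); rewrite -/(Y j _); lra.
  rewrite expr1n mul1r; apply: le_trans (X2 i).
  by apply: ler_sum => t _; case: (truncate_bound (X i t)).
(* X Y = tX tY + (X - tX) Y + tX (Y - tY): the first term costs 4 S, with 4 = 2 * 2 from the
   truncation height, and each of the others B / 4. *)
have split3 : N * \sum_i \sum_j F i j * (\sum_k u i k * v j k)
  = \sum_i \sum_j F i j * (\sum_t tX i t * tY j t)
  + \sum_i \sum_j F i j * (\sum_t (X i t - tX i t) * Y j t)
  + \sum_i \sum_j F i j * (\sum_t tX i t * (Y j t - tY j t)).
  rewrite mulr_sumr -!big_split; apply: eq_bigr => i _ /=.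
  rewrite mulr_sumr -!big_split; apply: eq_bigr => j _ /=.
  rewrite mulrCA -e2 -!mulrDr -!big_split; congr (_ * _).
  by apply: eq_bigr => t _ /=; rewrite -/(X i t) -/(Y j t); ring.
rewrite -(ler_pM2l N0) split3; lra.
Qed.

(** Cauchy-Schwarz without square roots: expand |u - v|^2 >= 0 and |u + v|^2 >= 0. *)
Lemma dot_le1 (K : realFieldType) (T : finType) (u v : T -> K) :
  \sum_t u t ^+ 2 <= 1 -> \sum_t v t ^+ 2 <= 1 -> `|\sum_t u t * v t| <= 1.
Proof.
move=> u1 v1.
have h0 : 0 <= \sum_t (u t - v t) ^+ 2 by apply: sumr_ge0 => t _; rewrite sqr_ge0.
have h1 : 0 <= \sum_t (u t + v t) ^+ 2 by apply: sumr_ge0 => t _; rewrite sqr_ge0.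
have e0 : \sum_t (u t - v t) ^+ 2
    = \sum_t u t ^+ 2 + \sum_t v t ^+ 2 - 2 * \sum_t u t * v t.
  by rewrite mulr_sumr -big_split -sumrB; apply: eq_bigr => t _ /=; ring.
have e1 : \sum_t (u t + v t) ^+ 2
    = \sum_t u t ^+ 2 + \sum_t v t ^+ 2 + 2 * \sum_t u t * v t.
  by rewrite mulr_sumr -!big_split; apply: eq_bigr => t _ /=; ring.
by rewrite ler_norml; lra.
Qed.

(** The map B -> 4 S + B / 2 has fixed point 8 S. Starting from the trivial bound, the excess over 8
    S halves at each iteration, and the Archimedean property removes it. *)
Lemma grothendieck (K : archiRealFieldType) (I J : finType) (F : I -> J -> K)
    (S : K) :
  (forall x y, (forall i, `|x i| <= 1) -> (forall j, `|y j| <= 1) ->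
     \sum_i \sum_j F i j * (x i * y j) <= S) ->
  vector_bound F (8 * S).
Proof.
move=> FS; pose B := \sum_i \sum_j `|F i j|.
have B0 : 0 <= B by apply: sumr_ge0 => i _; apply: sumr_ge0.
have FB k : vector_bound F (8 * S + B / 2 ^+ k).
  elim: k => [|k IHk].
    have S0 : 0 <= S.
      have := FS (fun=> 0) (fun=> 0); rewrite !normr0 => /(_ (fun=> ler01) (fun=> ler01)).
      by rewrite big1 // => i _; rewrite big1 // => j _; rewrite !mulr0.
    move=> T u v u1 v1; rewrite expr0 divr1 ler_wpDl ?mulr_ge0 //.
    apply: ler_sum => i _; apply: ler_sum => j _.
    apply: le_trans (ler_norm _) _; rewrite normrM -[leRHS]mulr1.
    by rewrite ler_wpM2l //; apply: dot_le1.
  have := vector_bound_step FS IHk; congr (vector_bound F _).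
  by rewrite exprS invfM; lra.
move=> T u v u1 v1; rewrite leNgt; apply/negP => gap.
set L := (X in _ < X) in gap; set d := L - 8 * S.
have d0 : 0 < d by rewrite subr_gt0.
pose k := Num.bound (B / d).
have Bk : B / d < 2 ^+ k.
  have Bd0 : 0 <= B / d by rewrite divr_ge0 // ltW.
  apply: lt_trans (archi_boundP Bd0) _.
  by rewrite -natrX ltr_nat ltn_expl.
have := FB k T u v u1 v1; rewrite -/L.
have : B / 2 ^+ k < d by rewrite ltr_pdivrMr ?exprn_gt0 // mulrC -ltr_pdivrMr.
rewrite /d; lra.
Qed.

(** * From fractional weights to subsets and rectangles *)

Lemma smallest_subset (K : realFieldType) (I : finType) (X : {set I}) (w : I -> K) k :
  (k <= #|X|)%N ->
  exists (X' : {set I}) (t : K),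
    [/\ X' \subset X, #|X'| = k, {in X', forall i, w i <= t} &
        {in X :\: X', forall i, t <= w i}].
Proof.
elim: k => [_|k IHk kX].
  (* With nothing chosen, the threshold must lie below every weight. *)
  exists set0, (- \sum_i `|w i|); split=> [||i|i _].
  - exact: sub0set.
  - exact: cards0.
  - by rewrite in_set0.
  - rewrite lerNl; apply: le_trans (ler_norm _) _; rewrite normrN.
    by rewrite (bigD1 i) //= lerDl sumr_ge0.
have [X' [t [X'X X'k X't Xt]]] := IHk (ltnW kX).
have [j0 j0X] : exists j, j \in X :\: X'.
  by apply/set0Pn; rewrite -card_gt0 cardsDS // X'k subn_gt0.
have [j jX jmin] := arg_minP w j0X.
have : j \in X :\: X' := jX; rewrite in_setD => /andP[jX' jX0].
exists (j |: X'), (w j); split=> [||i|i].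
- by rewrite subUset sub1set jX0.
- by rewrite cardsU1 jX' X'k.
- by rewrite in_setU1 => /predU1P[->//|/X't/le_trans]; apply; exact: Xt.
- rewrite in_setD in_setU1 negb_or -andbA => /and3P[_ iX' iX].
  by apply: jmin; apply/setDP.
Qed.

(** Choose the k smallest weights, with threshold t. If t < 0, all of them are negative. Otherwise
    moving the mass onto them does not increase the sum of the w - t, and the surplus mass times t
    is nonnegative. *)
Lemma fractional_subset (K : realFieldType) (I : finType) (X : {set I})
    (w x : I -> K) k :
  (0 < k)%N -> (forall i, 0 <= x i <= 1) -> k%:R <= \sum_(i in X) x i ->
  \sum_(i in X) x i * w i < 0 ->
  exists X' : {set I}, [/\ X' \subset X, #|X'| = k & \sum_(i in X') w i < 0].
Proof.
move=> k0 x01 kx xw.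
have kX : (k <= #|X|)%N.
  rewrite -(ler_nat K); apply: le_trans kx _.
  by rewrite -sumr_const; apply: ler_sum => i _; case/andP: (x01 i).
have [X' [t [X'X X'k X't Xt]]] := smallest_subset w kX.
exists X'; split=> //.
have [t0|t0] := ltP t 0.
  apply: le_lt_trans (_ : \sum_(i in X') t < 0); first by apply: ler_sum => i /X't.
  by rewrite sumr_const X'k pmulrn_llt0.
apply: le_lt_trans xw.
have h : \sum_(i in X') (w i - t) <= \sum_(i in X) x i * (w i - t).
  rewrite [leRHS](big_setID X') /= (setIidPr X'X) -[leLHS]addr0; apply: lerD.
    apply: ler_sum => i iX'.
    have := X't i iX'; have /andP[_] := x01 i; nra.
  apply: sumr_ge0 => i iX; apply: mulr_ge0; first by case/andP: (x01 i).
  by rewrite subr_ge0; exact: Xt.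
move: h; rewrite sumrB sumr_const X'k -mulr_natl.
under [X in _ <= X -> _]eq_bigr do rewrite mulrBr.
rewrite sumrB -mulr_suml.
have : 0 <= (\sum_(i in X) x i - k%:R) * t by rewrite mulr_ge0 // subr_ge0.
lra.
Qed.

(** Round the rows first, with the columns still fractional, then the columns. *)
Lemma fractional_rectangle (K : realFieldType) (I J : finType) (X : {set I})
    (Y : {set J}) (F : I -> J -> K) (x : I -> K) (y : J -> K) k :
  (0 < k)%N -> (forall i, 0 <= x i <= 1) -> (forall j, 0 <= y j <= 1) ->
  k%:R <= \sum_(i in X) x i -> k%:R <= \sum_(j in Y) y j ->
  \sum_(i in X) \sum_(j in Y) F i j * (x i * y j) < 0 ->
  exists (X' : {set I}) (Y' : {set J}),
    [/\ X' \subset X, Y' \subset Y, #|X'| = k, #|Y'| = k &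
        \sum_(i in X') \sum_(j in Y') F i j < 0].
Proof.
move=> k0 x01 y01 kx ky Fxy.
have [|X' [X'X X'k FX']] := fractional_subset (w := fun i => \sum_(j in Y) F i j * y j) k0 x01 kx.
  congr (_ < 0) : Fxy; apply: eq_bigr => i _; rewrite mulr_sumr.
  by apply: eq_bigr => j _; ring.
have [|Y' [Y'Y Y'k FY']] := fractional_subset (w := fun j => \sum_(i in X') F i j) k0 y01 ky.
  congr (_ < 0) : FX'; rewrite exchange_big; apply: eq_bigr => j _ /=.
  by rewrite mulr_sumr; apply: eq_bigr => i _; ring.
by exists X', Y'; split=> //; rewrite exchange_big.
Qed.

(* The weights 1/2 + x/4 and 1/2 - x/4 both have mass at least |X|/4, and
   4 - x y = 8 ((1/2 + x/4) (1/2 - y/4) + (1/2 - x/4) (1/2 + y/4)). *)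
Lemma signed_rectangle_bound (K : realFieldType) (I J : finType) (X : {set I})
    (Y : {set J}) (F : I -> J -> K) k (x : I -> K) (y : J -> K) :
  (0 < k)%N -> (4 * k <= #|X|)%N -> (4 * k <= #|Y|)%N ->
  (forall (X' : {set I}) (Y' : {set J}), X' \subset X -> Y' \subset Y ->
     #|X'| = k -> #|Y'| = k -> 0 <= \sum_(i in X') \sum_(j in Y') F i j) ->
  (forall i, `|x i| <= 1) -> (forall j, `|y j| <= 1) ->
  \sum_(i in X) \sum_(j in Y) F i j * (x i * y j)
    <= 4 * \sum_(i in X) \sum_(j in Y) F i j.
Proof.
move=> k0 kX kY F0 x1 y1.
have weight01 (T : finType) (z : T -> K) : (forall i, `|z i| <= 1) ->
    forall i, 0 <= 2^-1 + z i / 4 <= 1.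
  by move=> z1 i; have := z1 i; rewrite ler_norml; lra.
have weight_sum (T : finType) (Z : {set T}) (z : T -> K) : (4 * k <= #|Z|)%N ->
    (forall i, `|z i| <= 1) -> k%:R <= \sum_(i in Z) (2^-1 + z i / 4).
  move=> kZ z1; apply: le_trans (_ : \sum_(i in Z) 4^-1 <= _).
    rewrite sumr_const -[leRHS]mulr_natl ler_pdivlMr // -natrM ler_nat; lia.
  by apply: ler_sum => i _; have := z1 i; rewrite ler_norml; lra.
have mixed (x' : I -> K) (y' : J -> K) : (forall i, `|x' i| <= 1) ->
    (forall j, `|y' j| <= 1) ->
    0 <= \sum_(i in X) \sum_(j in Y) F i j * ((2^-1 + x' i / 4) * (2^-1 + y' j / 4)).
  move=> x'1 y'1; rewrite leNgt; apply/negP => neg.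
  have [X' [Y' [X'X Y'Y X'k Y'k]]] := fractional_rectangle k0 (weight01 _ _ x'1)
    (weight01 _ _ y'1) (weight_sum _ _ _ kX x'1) (weight_sum _ _ _ kY y'1) neg.
  by rewrite ltNge F0.
have xN i : `|- x i| <= 1 by rewrite normrN.
have yN j : `|- y j| <= 1 by rewrite normrN.
have := mixed _ _ x1 yN; have := mixed _ _ xN y1.
set f := \sum_(i in X) _; set g := \sum_(i in X) _ => f0 g0.
suff : 4 * \sum_(i in X) \sum_(j in Y) F i j
    - \sum_(i in X) \sum_(j in Y) F i j * (x i * y j) = 8 * f + 8 * g by lra.
rewrite !mulr_sumr -sumrB -big_split; apply: eq_bigr => i _ /=.
rewrite !mulr_sumr -sumrB -big_split; apply: eq_bigr => j _ /=.
by field.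
Qed.

(** * Factorization through vectors of small norm *)

(** Markov's inequality: if more than half of the weights exceeded 2 c / |X|, their sum would exceed
    c. The condition is cleared of its denominator. *)
Lemma markov_half (K : realFieldType) (I : finType) (X : {set I}) (w : I -> K) (c : K) :
  (forall i, 0 <= w i) -> 0 <= c -> \sum_(i in X) w i <= c ->
  (#|X| <= 2 * #|[set i in X | (#|X|%:R * w i <= 2 * c)%R]|)%N.
Proof.
move=> w0 c0 wc; set A := [set i in X | _].
have AX : A \subset X by apply/subsetP => i; rewrite inE => /andP[].
rewrite leqNgt; apply/negP => small.
have card_rest : (#|X| < 2 * #|X :\: A|)%N.
  have := subset_leq_card AX; rewrite cardsDS //; lia.
have [i0 i0A] : exists i, i \in X :\: A by apply/set0Pn; rewrite -card_gt0; lia.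
have big i : i \in X :\: A -> 2 * c < #|X|%:R * w i.
  by rewrite !inE => /andP[+ iX]; rewrite iX /= -ltNge.
have X0 : 0 < #|X|%:R :> K.
  by rewrite ltr0n card_gt0; apply/set0Pn; exists i0; move: i0A; rewrite in_setD => /andP[].
have : #|X :\: A|%:R * (2 * c) < #|X|%:R * \sum_(i in X :\: A) w i.
  rewrite mulr_sumr mulr_natl -sumr_const [ltLHS](bigD1 i0) // [ltRHS](bigD1 i0) //=.
  by apply: ltr_leD; [exact: big | apply: ler_sum => i /andP[/big/ltW]].
have : \sum_(i in X :\: A) w i <= c.
  apply: le_trans wc; rewrite [leRHS](big_setID A) /= addrC (setIidPr AX) lerDl.
  by apply: sumr_ge0.
have : #|X|%:R <= 2 * #|X :\: A|%:R :> K by rewrite -natrM ler_nat ltnW.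
move=> hN hS; apply/negP; rewrite -leNgt.
apply: le_trans (_ : #|X|%:R * c <= _); first by rewrite ler_pM2l.
have := ler_wpM2r c0 hN; lra.
Qed.

Lemma row_mask_rank (K : fieldType) m n (A : 'M[K]_(m, n)) (X : {set 'I_m}) :
  (\rank (\matrix_(i, j) (if i \in X then A i j else 0)%R) <= \rank A)%N.
Proof.
have -> : \matrix_(i, j) (if i \in X then A i j else 0)
    = diag_mx (\row_i (i \in X)%:R) *m A.
  apply/matrixP => i j; rewrite mul_diag_mx !mxE.
  by case: (i \in X); rewrite ?mul1r ?mul0r.
exact: mxrankM_maxr.
Qed.

(** Rank is invariant under field extension, so the argument may move from the rationals to a field
    with square roots. *)
Lemma bool_rank_field (K : numFieldType) n (M : 'M[bool]_n) :
  \rank (\matrix_(i, j) (M i j)%:R : 'M[K]_n) = bool_rank M.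
Proof.
rewrite /bool_rank -(mxrank_map (ratr : {rmorphism rat -> K})); congr (\rank _).
by apply/matrixP => i j; rewrite !mxE rmorph_nat.
Qed.

Definition mass (K : realFieldType) n (M : 'M[bool]_n) (X Y : {set 'I_n}) : K :=
  \sum_(i in X) \sum_(j in Y) (M i j)%:R.

(* The vectors are the rows of the orthogonal projection onto the column space
   (squared norms summing to the rank) against the columns of the matrix
   (squared norms summing to the number of ones). *)
Lemma low_norm_factorization (K : rcfType) n (M : 'M[bool]_n) r N
    (X Y : {set 'I_n}) (p D : K) :
  (0 < r)%N -> (bool_rank M <= r)%N -> (0 < N)%N -> #|X| = N -> #|Y| = N ->
  0 <= p -> mass K M X Y <= p * N%:R ^+ 2 -> 0 < D -> 4 * r%:R * p <= D ^+ 2 ->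
  exists (S T : {set 'I_n}) (u v : 'I_n -> 'I_n -> K),
    [/\ [/\ S \subset X, T \subset Y, (N <= 2 * #|S|)%N & (N <= 2 * #|T|)%N],
        forall i, \sum_k u i k ^+ 2 <= 1, forall j, \sum_k v j k ^+ 2 <= 1 &
        forall i j, D * (\sum_k u i k * v j k)
          = if (i \in S) && (j \in T) then (M i j)%:R else 0].
Proof.
move=> r0 Mr N0 XN YN p0 Mp D0 Dp.
(* Rows outside X are zeroed, so that the column norms count only the ones in X. Columns are left
   alone, as only those in Y get selected. *)
pose A : 'M[K]_n := \matrix_(i, j)
  (if i \in X then (\matrix_(i, j) (M i j)%:R : 'M[K]_n) i j else 0).
have rkA : (\rank A <= r)%N by rewrite (leq_trans (row_mask_rank _ _)) // bool_rank_field.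
have [P [PT PP PA trP]] := ortho_proj A.
have PiiE i : P i i = \sum_k P i k ^+ 2.
  rewrite -{1}PP mxE; apply: eq_bigr => k _.
  by rewrite -{2}PT mxE expr2.
have Pii0 i : 0 <= P i i by rewrite PiiE sumr_ge0 // => k _; rewrite sqr_ge0.
have sumP : \sum_(i in X) P i i <= r%:R.
  apply: le_trans (_ : (\rank A)%:R <= _); last by rewrite ler_nat.
  by rewrite -trP /mxtrace [leRHS](bigID (mem X)) /= lerDl sumr_ge0.
pose c j := \sum_k A k j ^+ 2.
have c0 j : 0 <= c j by rewrite sumr_ge0 // => k _; rewrite sqr_ge0.
have sumc : \sum_(j in Y) c j <= p * N%:R ^+ 2.
  apply: le_trans Mp; rewrite /mass [leRHS]exchange_big /=.
  apply: ler_sum => j _; rewrite /c [leRHS]big_mkcond /=.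
  apply: ler_sum => k _; rewrite !mxE; case: (k \in X); rewrite ?expr0n //.
  by case: (M k j); rewrite ?expr0n ?expr1n.
have NK : 0 < N%:R :> K by rewrite ltr0n.
have rK : 0 < r%:R :> K by rewrite ltr0n.
have pN0 : 0 <= p * N%:R ^+ 2 by rewrite mulr_ge0 ?sqr_ge0.
have := markov_half Pii0 (ltW rK) sumP; have := markov_half c0 pN0 sumc.
set T := [set j in Y | _]; set S := [set i in X | _]; rewrite XN YN => TN SN.
(* On S the rows of P have squared norm at most 2 r / N = a^2; on T the columns have at most 2 p N.
   Hence the scaled columns have squared norm at most 4 r p / D^2 <= 1. *)
pose a : K := Num.sqrt (2 * r%:R / N%:R).
have a2 : a ^+ 2 = 2 * r%:R / N%:R by rewrite sqr_sqrtr // divr_ge0 ?mulr_ge0 // ltW.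
have a0 : 0 < a by rewrite sqrtr_gt0 divr_gt0 ?mulr_gt0.
exists S, T, (fun i k => if i \in S then P i k / a else 0),
  (fun j k => if j \in T then a / D * A k j else 0).
split; first split.
- by apply/subsetP => i; rewrite inE => /andP[].
- by apply/subsetP => j; rewrite inE => /andP[].
- by [].
- by [].
- move=> i; case: (boolP (i \in S)) => [|_] /=; last by rewrite big1 // => k _; rewrite expr0n.
  rewrite inE XN => /andP[_ iS].
  under eq_bigr do rewrite expr_div_n.
  rewrite -mulr_suml -PiiE ler_pdivrMr ?exprn_gt0 // mul1r a2.
  by rewrite ler_pdivlMr // mulrC.
- move=> j; case: (boolP (j \in T)) => [|_] /=; last by rewrite big1 // => k _; rewrite expr0n.
  rewrite inE YN => /andP[_ jT].
  under eq_bigr do rewrite exprMn expr_div_n.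
  rewrite -mulr_sumr -/(c j) a2.
  have -> : 2 * r%:R / N%:R / D ^+ 2 * c j = 2 * r%:R * c j / N%:R / D ^+ 2.
    by field; rewrite !lt0r_neq0.
  rewrite ler_pdivrMr ?exprn_gt0 // mul1r; apply: le_trans Dp.
  rewrite ler_pdivrMr //.
  rewrite -(ler_pM2l NK); have : N%:R * c j * (2 * r%:R) <= 2 * (p * N%:R ^+ 2) * (2 * r%:R).
    by rewrite ler_wpM2r // mulr_ge0 // ltW.
  by congr (_ <= _); ring.
- move=> i j; case: (boolP (i \in S)) => [iS|_] /=; last first.
    by rewrite big1 ?mulr0 // => k _; rewrite mul0r.
  case: (boolP (j \in T)) => [jT|_] /=; last by rewrite big1 ?mulr0 // => k _; rewrite mulr0.
  have iX : i \in X by move: iS; rewrite inE => /andP[].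
  transitivity (A i j); last by rewrite !mxE iX.
  rewrite -{2}PA mxE mulr_sumr; apply: eq_bigr => k _.
  by field; rewrite !lt0r_neq0.
Qed.

(** * Zero rectangles by density decrement *)

(** With D = 1/2, every entry on the selected rectangle is at most 1/2 in absolute value, hence
    0. *)
Lemma low_density_zero_rect (K : rcfType) n (M : 'M[bool]_n) r N
    (X Y : {set 'I_n}) (p : K) :
  (0 < r)%N -> (bool_rank M <= r)%N -> (0 < N)%N -> #|X| = N -> #|Y| = N ->
  0 <= p -> mass K M X Y <= p * N%:R ^+ 2 -> 16 * r%:R * p <= 1 ->
  exists S T : {set 'I_n},
    [/\ zero_rect M S T, (N <= 2 * #|S|)%N & (N <= 2 * #|T|)%N].
Proof.
move=> r0 Mr N0 XN YN p0 Mp rp.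
have rp' : 4 * r%:R * p <= 2^-1 ^+ 2 by lra.
have h0 : 0 < 2^-1 :> K by lra.
have [S [T [u [v [[_ _ SN TN] u1 v1 uv]]]]] :=
  low_norm_factorization r0 Mr N0 XN YN p0 Mp h0 rp'.
exists S, T; split=> //; apply/forall_inP => i iS; apply/forall_inP => j jT.
apply/negP => Mij; have := uv i j; rewrite iS jT Mij /=.
by have := dot_le1 (u1 i) (v1 j); rewrite ler_norml; lra.
Qed.

(** If every k x k submatrix has density above q, Grothendieck bounds the form of M - q on the
    factor vectors by 32 (p - q) N^2. Multiplied by D this form is (1 - q) times the number of ones
    on S x T, at least q N^2 / 8, which contradicts the gap as 256 = 8 * 32. *)
Lemma density_decrement (K : archiRcfType) n (M : 'M[bool]_n) r N k
    (X Y : {set 'I_n}) (p q D : K) :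
  (0 < r)%N -> (bool_rank M <= r)%N -> #|X| = N -> #|Y| = N ->
  (0 < k)%N -> (4 * k <= N)%N -> 0 < q -> q <= p -> p <= 2^-1 ->
  mass K M X Y <= p * N%:R ^+ 2 -> 0 < D -> 4 * r%:R * p <= D ^+ 2 ->
  256 * D * (p - q) < q ->
  exists X' Y' : {set 'I_n},
    [/\ #|X'| = k, #|Y'| = k & mass K M X' Y' <= q * k%:R ^+ 2].
Proof.
move=> r0 Mr XN YN k0 kN q0 qp p2 Mp D0 rp gap.
case: (boolP [exists X' : {set 'I_n}, exists Y' : {set 'I_n},
    [&& #|X'| == k, #|Y'| == k & mass K M X' Y' <= q * k%:R ^+ 2]]).
  by case/existsP=> X' /existsP[Y' /and3P[/eqP ? /eqP ? ?]]; exists X', Y'.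
move=> /existsPn dense.
pose G i j : K := (M i j)%:R - q.
have sumG (S T : {set 'I_n}) :
    \sum_(i in S) \sum_(j in T) G i j = mass K M S T - q * #|S|%:R * #|T|%:R.
  rewrite /G /mass; under eq_bigr do rewrite sumrB sumr_const.
  by rewrite sumrB sumr_const -[q *+ _ *+ _]mulr_natr -[q *+ _]mulr_natr; ring.
have denseG (X' Y' : {set 'I_n}) : #|X'| = k -> #|Y'| = k ->
    0 <= \sum_(i in X') \sum_(j in Y') G i j.
  move=> X'k Y'k; have /existsPn/(_ Y') := dense X'.
  by rewrite sumG X'k Y'k !eqxx /= -ltNge => /ltW; rewrite subr_ge0; lra.
have N0 : (0 < N)%N by lia.
have NK : 0 < N%:R :> K by rewrite ltr0n.
have [S [T [u [v [[SX TY SN TN] u1 v1 uv]]]]] :=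
  low_norm_factorization r0 Mr N0 XN YN (le_trans (ltW q0) qp) Mp D0 rp.
(* Grothendieck sums over all indices, so M - q is cut down to X x Y. *)
pose F i j : K := if (i \in X) && (j \in Y) then G i j else 0.
have upper : \sum_i \sum_j F i j * (\sum_t u i t * v j t)
    <= 8 * (4 * (p - q) * N%:R ^+ 2).
  apply: grothendieck u1 v1 => x y x1 y1.
  have -> : \sum_i \sum_j F i j * (x i * y j)
      = \sum_(i in X) \sum_(j in Y) G i j * (x i * y j).
    rewrite [RHS]big_mkcond; apply: eq_bigr => i _; rewrite /F.
    case: (i \in X) => /=; last by rewrite big1 // => j _; rewrite mul0r.
    by rewrite [RHS]big_mkcond; apply: eq_bigr => j _; case: (j \in Y); rewrite ?mul0r.
  apply: (le_trans (signed_rectangle_bound k0 _ _ _ x1 y1)); rewrite ?XN ?YN //.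
    by move=> X' Y' _ _; exact: denseG.
  by rewrite sumG XN YN; lra.
(* The inner products reproduce M on S x T and vanish elsewhere, and (M - q) M = (1 - q) M for 0/1
   entries. *)
have lower : D * \sum_i \sum_j F i j * (\sum_t u i t * v j t)
    = (1 - q) * mass K M S T.
  rewrite /mass !mulr_sumr [RHS]big_mkcond; apply: eq_bigr => i _.
  rewrite mulr_sumr; case: (boolP (i \in S)) => iS; last first.
    by rewrite big1 // => j _; rewrite mulrCA uv (negbTE iS) mulr0.
  rewrite mulr_sumr [RHS]big_mkcond; apply: eq_bigr => j _.
  rewrite mulrCA uv iS /=; case: (boolP (j \in T)) => jT /=; last by rewrite mulr0.
  rewrite /F (subsetP SX) // (subsetP TY) //= /G.
  by case: (M i j); rewrite ?mulr1 ?mulr0.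
(* Density passes from k x k subrectangles up to S x T: otherwise rounding the constant weights 1
   would give a k x k one of density below q. *)
have ST : q * #|S|%:R * #|T|%:R <= mass K M S T.
  rewrite -subr_ge0 -sumG leNgt; apply/negP => neg.
  have one01 (i : 'I_n) : 0 <= (1 : K) <= 1 by rewrite ler01 lexx.
  have kcard (Z : {set 'I_n}) : (N <= 2 * #|Z|)%N -> k%:R <= \sum_(i in Z) (1 : K).
    by move=> ZN; rewrite sumr_const ler_nat; move: kN ZN; clear; lia.
  have [|X' [Y' [_ _ X'k Y'k]]] := fractional_rectangle (F := G) k0 one01 one01
    (kcard _ SN) (kcard _ TN).
    by under eq_bigr do under eq_bigr do rewrite !mulr1.
  by rewrite ltNge denseG.
have SN' : N%:R <= 2 * #|S|%:R :> K by rewrite -natrM ler_nat.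
have TN' : N%:R <= 2 * #|T|%:R :> K by rewrite -natrM ler_nat.
have : N%:R ^+ 2 <= 4 * (#|S|%:R * #|T|%:R) :> K.
  have -> : 4 * (#|S|%:R * #|T|%:R) = (2 * #|S|%:R) * (2 * #|T|%:R) :> K by ring.
  by rewrite expr2; apply: ler_pM => //; exact: ltW.
rewrite -(ler_pM2l q0) => STN.
have mST : mass K M S T / 2 <= (1 - q) * mass K M S T.
  have : 0 <= mass K M S T by apply: sumr_ge0 => i _; apply: sumr_ge0 => j _; rewrite ler0n.
  have : 2^-1 <= 1 - q by lra.
  nra.
have : q * N%:R ^+ 2 <= 256 * D * (p - q) * N%:R ^+ 2.
  have := ler_wpM2l (ltW D0) upper; rewrite lower; lra.
by rewrite ler_pM2r ?exprn_gt0 // leNgt gap.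
Qed.

(** Ends the descent when N < 4, where N %/ 4 would be 0. *)
Lemma half_density_zero_entry (K : realFieldType) n (M : 'M[bool]_n)
    (X Y : {set 'I_n}) N :
  (0 < N)%N -> #|X| = N -> #|Y| = N -> mass K M X Y <= 2^-1 * N%:R ^+ 2 ->
  exists X' Y' : {set 'I_n}, [/\ zero_rect M X' Y', #|X'| = 1%N & #|Y'| = 1%N].
Proof.
move=> N0 XN YN MN.
case: (boolP [exists i in X, exists j in Y, ~~ M i j]).
  case/exists_inP => i iX /exists_inP[j jY Mij].
  exists [set i], [set j]; rewrite !cards1; split=> //.
  by apply/forall_inP => i'; rewrite inE => /eqP->; apply/forall_inP => j'; rewrite inE => /eqP->.
move=> /exists_inPn full; exfalso.
have : mass K M X Y = N%:R ^+ 2.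
  transitivity (\sum_(i in X) \sum_(j in Y) (1 : K)).
    apply: eq_bigr => i iX; apply: eq_bigr => j jY.
    by have /exists_inPn/(_ j jY) := full i iX; rewrite negbK => ->.
  under eq_bigr do rewrite sumr_const YN.
  by rewrite sumr_const XN -[_ *+ N *+ N]mulr_natr expr2.
have : 0 < N%:R ^+ 2 :> K by rewrite exprn_gt0 ?ltr0n.
lra.
Qed.

(* With 4^s ~ r, the density at level j is 4^j / (32 * 4^s): at most 1/(16 r) at
   level 0, and 1/2 at level s + 2. Each level costs L * 2^j decrements. *)
Lemma zero_rect_from_level (K : archiRcfType) n (M : 'M[bool]_n) r s j L :
  (768 < L)%N ->
  (0 < r)%N -> (bool_rank M <= r)%N -> (r <= 4 ^ s)%N -> (j <= s.+2)%N ->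
  forall (X Y : {set 'I_n}) N, (0 < N)%N -> #|X| = N -> #|Y| = N ->
  mass K M X Y <= 4 ^+ j / (32 * 4 ^+ s) * N%:R ^+ 2 ->
  exists X' Y' : {set 'I_n},
    [/\ zero_rect M X' Y', #|X'| = #|Y'| & (N <= #|X'| * 8 ^ (L * 2 ^ j))%N].
Proof.
move=> L768 r0 Mr rs; have L0 : 768 < L%:R :> K by rewrite (ltr_nat K 768).
have s0 : 0 < 4 ^+ s :> K by rewrite exprn_gt0.
have rs' : r%:R <= 4 ^+ s :> K by rewrite -natrX ler_nat.
elim: j => [_|j IHj js] X Y N N0 XN YN MN.
  have p0 : 0 <= 4 ^+ 0 / (32 * 4 ^+ s) :> K by rewrite divr_ge0 ?mulr_ge0 ?ltW.
  have [|S [T [ST SN TN]]] := low_density_zero_rect r0 Mr N0 XN YN p0 MN.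
    by rewrite expr0 mul1r ler_pdivrMr ?mulr_gt0 // mul1r; lra.
  (* Constant weights reduce [smallest_subset] to picking a subset of given size; both sides are
     trimmed to half of N, rounded up. *)
  have [S' [_ [S'S S'k _ _]]] := @smallest_subset K _ S (fun=> 0) (uphalf N) ltac:(lia).
  have [T' [_ [T'T T'k _ _]]] := @smallest_subset K _ T (fun=> 0) (uphalf N) ltac:(lia).
  exists S', T'; rewrite S'k T'k; split=> //.
    apply/forall_inP => i iS; apply/forall_inP => k kT.
    by have /forall_inP/(_ i (subsetP S'S _ iS))/forall_inP := ST; apply; exact: (subsetP T'T).
  apply: (@leq_trans (uphalf N * 8 ^ 1)); first by move: N0; clear; lia.
  by rewrite leq_mul2l leq_pexp2l ?orbT // expn0 muln1; lia.
pose P : K := 4 ^+ j / (32 * 4 ^+ s).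
have P0 : 0 < P by rewrite divr_gt0 ?mulr_gt0 ?exprn_gt0.
(* L 2^j decrements of size e lead from density 4 P down to P. With D = 2^j, the gap condition reads
   256 D e = 768 P / L < q, which follows from L > 768 and P <= q. *)
pose e : K := 3 * P / (L%:R * 2 ^+ j).
have LK : 0 < L%:R :> K by lra.
have D0 : 0 < 2 ^+ j :> K by rewrite exprn_gt0.
have e0 : 0 < e by apply: divr_gt0; apply: mulr_gt0.
have De0 : 0 < 2 ^+ j * e := mulr_gt0 D0 e0.
have P4 : 4 ^+ j.+1 / (32 * 4 ^+ s) = 4 * P by rewrite /P exprS mulrA.
have P4_half : 4 * P <= 2^-1.
  rewrite -P4 ler_pdivrMr ?mulr_gt0 // [leRHS](_ : _ = 4 ^+ s.+2); last by rewrite !exprS; field.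
  by rewrite ler_weXn2l // ler1n.
have rP : 4 * r%:R * (4 * P) <= (2 ^+ j) ^+ 2.
  rewrite -exprM mulnC exprM (_ : 2 ^+ 2 = 4); last by ring.
  apply: le_trans (_ : 4 * 4 ^+ s * (4 * P) <= _).
    by rewrite ler_pM2r; [rewrite ler_pM2l | apply: mulr_gt0].
  have -> : 4 * 4 ^+ s * (4 * P) = 4 ^+ j / 2 by rewrite /P; field; rewrite lt0r_neq0.
  by have : 0 < 4 ^+ j :> K by [rewrite exprn_gt0]; lra.
have steps : 4 * P = P + (L * 2 ^ j)%:R * e.
  by rewrite /e natrM natrX; field; rewrite !lt0r_neq0.
(* Here t counts the decrements left before density P. Each costs a factor 8, since N <= 8 (N %/ 4)
   once N >= 4. *)
have descend t : (t <= L * 2 ^ j)%N ->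
    forall (X Y : {set 'I_n}) N, (0 < N)%N -> #|X| = N -> #|Y| = N ->
    mass K M X Y <= (P + t%:R * e) * N%:R ^+ 2 ->
    exists X' Y' : {set 'I_n}, [/\ zero_rect M X' Y', #|X'| = #|Y'| &
      (N <= #|X'| * 8 ^ (L * 2 ^ j + t))%N].
  clear X Y N N0 XN YN MN.
  elim: t => [_|t IHt tT] X Y N N0 XN YN MN.
    rewrite mul0r addr0 in MN; rewrite addn0.
    by apply: IHj MN => //; exact: ltnW.
  have le4P : P + t.+1%:R * e <= 4 * P.
    by rewrite steps lerD2l ler_pM2r // ler_nat.
  have [N4|N4] := ltnP N 4.
    have [|X' [Y' [ZX X1 Y1]]] := half_density_zero_entry (K := K) (M := M) N0 XN YN.
      apply: (le_trans MN); rewrite ler_pM2r ?exprn_gt0 ?ltr0n //;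
      exact: (le_trans le4P P4_half).
    exists X', Y'; rewrite X1 Y1 mul1n; split=> //.
    apply: (@leq_trans (8 ^ 1)%N); first by rewrite expn1 (leq_trans (ltnW N4)).
    by rewrite leq_pexp2l // addnS.
  have te0 : 0 <= t%:R * e by rewrite mulr_ge0 ?ler0n ?ltW.
  have tS : t.+1%:R * e = t%:R * e + e by rewrite -natr1 mulrDl mul1r.
  have eD : L%:R * (2 ^+ j * e) = 3 * P by rewrite /e; field; rewrite !lt0r_neq0.
  have k0 : (0 < N %/ 4)%N by rewrite divn_gt0.
  have kN : (4 * (N %/ 4) <= N)%N by rewrite mulnC leq_divM.
  have [||||X' [Y' [X'k Y'k MX']]] := density_decrement (q := P + t%:R * e) r0 Mr XN YN k0 kN
    _ _ (le_trans le4P P4_half) MN D0 _ _.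
  - by rewrite ltr_pwDl.
  - by rewrite tS; lra.
  - by apply: le_trans rP; rewrite ler_pM2l ?mulr_gt0 ?ltr0n.
  - rewrite tS; apply: (@lt_le_trans _ _ P); last by rewrite lerDl.
    have : 768 * (2 ^+ j * e) < 3 * P by rewrite -eD ltr_pM2r.
    lra.
  have [X2 [Y2 [Z XY NX]]] := IHt (ltnW tT) X' Y' _ k0 X'k Y'k MX'.
  exists X2, Y2; split=> //; rewrite addnS expnS; move: N4 NX; clear; nia.
rewrite P4 steps in MN.
(* The exponent L 2^j of the lower levels and the L 2^j decrements of this one add up to L
   2^(j+1). *)
have [X' [Y' [Z XY NX]]] := descend _ (leqnn _) X Y N N0 XN YN MN.
exists X', Y'; split=> //; rewrite (_ : L * 2 ^ j.+1 = L * 2 ^ j + L * 2 ^ j)%N //.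
by rewrite expnS mulnCA mul2n addnn.
Qed.

(** * The bound on [zM], first over the integers, then over the reals *)

Lemma mass_setT (K : realFieldType) n (M : 'M[bool]_n) :
  mass K M setT setT = (ones M)%:R.
Proof.
rewrite /mass pair_big /= /ones -sum1_card natr_sum [RHS]big_mkcond /=.
rewrite big_mkcond; apply: eq_bigr => -[i j] _; rewrite !inE /=.
by case: (M i j).
Qed.

Lemma leq_zM n (M : 'M[bool]_n) (X Y : {set 'I_n}) :
  #|X| = #|Y| -> zero_rect M X Y -> (#|X| <= zM M)%N.
Proof.
move=> XY Z; have Xn : (#|X| < n.+1)%N by rewrite ltnS -[leqRHS]card_ord max_card.
rewrite /zM (bigop.bigmax_sup (Ordinal Xn)) //.
by apply/existsP; exists X; apply/existsP; exists Y; rewrite eqxx -XY eqxx Z.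
Qed.

Lemma leq_zM_exp (K : archiRcfType) n r s L (M : 'M[bool]_n) :
  (768 < L)%N -> (0 < r)%N -> (bool_rank M <= r)%N -> (2 * ones M <= n * n)%N ->
  (r <= 4 ^ s)%N -> (n <= zM M * 8 ^ (L * 2 ^ s.+2))%N.
Proof.
move=> L768 r0 Mr Mn rs; have [n0|n0] := posnP n; first by rewrite [leqLHS]n0.
have cardT : #|[set: 'I_n]| = n by rewrite cardsT card_ord.
have [|X [Y [Z XY nX]]] := zero_rect_from_level (K := K) (j := s.+2) L768 r0 Mr rs
  (leqnn _) n0 cardT cardT.
  have -> : 4 ^+ s.+2 / (32 * 4 ^+ s) = 2^-1 :> K.
    by rewrite !exprS; field; rewrite lt0r_neq0 ?exprn_gt0.
  by rewrite mass_setT mulrC ler_pdivlMr // mulrC -natrX -natrM ler_nat -mulnn.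
by apply: (leq_trans nX); rewrite leq_mul2r (leq_zM XY Z) orbT.
Qed.

(** Rounding r up to a power of 4 loses less than a factor 4; the second bound says 2^s <= 2 sqrt r
    without a root. *)
Lemma exp4_approx r : (0 < r)%N ->
  exists s, (r <= 4 ^ s)%N /\ (2 ^ s * 2 ^ s <= 4 * r)%N.
Proof.
move=> r0; exists (up_log 4 r); split; first exact: up_logP.
rewrite -expnMn.
have [r1|r1] := leqP r 1.
  by rewrite (_ : r = 1%N) //; apply/eqP; rewrite eqn_leq r1.
have /andP[+ _] := up_log_bounds (isT : 1 < 4)%N r1.
case: (up_log 4 r) => [|k]; first by rewrite muln_gt0.
by rewrite expnS /= => /ltnW; rewrite leq_mul2l.
Qed.

Local Close Scope ring_scope.
From Stdlib Require Import Reals Lra.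

Lemma INR_expn m k : INR (expn m k) = (INR m ^ k)%R.
Proof. by elim: k => [//|k IHk]; rewrite expnS mult_INR IHk. Qed.

Lemma zM_Rpower n r L (M : 'M[bool]_n) :
  (768 < L)%N -> (0 < r)%N -> (bool_rank M <= r)%N -> (2 * ones M <= n * n)%N ->
  (INR (zM M) >= INR n / Rpower 2 (INR (24 * L) * sqrt (INR r)))%R.
Proof.
move=> L768 r0 Mr Mn.
have [s [rs sr]] := exp4_approx r0.
have r0' : (0 <= INR r)%R by apply: pos_INR.
have sqrt_s : (INR (expn 2 s) <= 2 * sqrt (INR r))%R.
  have <- : sqrt (INR (muln (expn 2 s) (expn 2 s))) = INR (expn 2 s).
    by rewrite mult_INR sqrt_square //; exact: pos_INR.
  have -> : (2 * sqrt (INR r) = sqrt (INR (4 * r)))%R.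
    rewrite mult_INR sqrt_mult //; last exact: pos_INR.
    have -> : INR 4 = (2 * 2)%R by rewrite /=; Lra.lra.
    by rewrite sqrt_square //; Lra.lra.
  by apply: sqrt_le_1; [exact: pos_INR | exact: pos_INR | exact: (le_INR _ _ (ssrnat.leP sr))].
(* The real algebraic numbers serve as the Archimedean real closed field; the conclusion no longer
   mentions it. *)
have nz := leq_zM_exp realalg L768 r0 Mr Mn rs.
have : (INR n <= INR (zM M) * Rpower 2 (INR (24 * L) * sqrt (INR r)))%R.
  apply: (Rle_trans _ _ _ (le_INR _ _ (ssrnat.leP nz))).
  rewrite mult_INR; apply: Rmult_le_compat_l; first exact: pos_INR.
  (* 8^(L 2^(s+2)) = 2^(12 L 2^s), and 2^s <= 2 sqrt r yields the constant 24 L. *)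
  rewrite (_ : expn 8 _ = expn 2 (12 * L * expn 2 s)); last first.
    rewrite (_ : 8 = expn 2 3) // -expnM !expnS; congr expn.
    by rewrite (mulnC 12 L) !mulnA (mulnC 3 L) -!mulnA; congr (muln L _); rewrite !mulnA.
  rewrite INR_expn -Rpower_pow; last by rewrite /=; Lra.lra.
  rewrite (_ : INR 2 = 2%R) //; apply: Rle_Rpower; first Lra.lra.
  rewrite (_ : 24 * L = 12 * L * 2)%N; last by rewrite mulnAC.
  rewrite !(mult_INR (12 * L)) Rmult_assoc; apply: Rmult_le_compat_l => //.
  exact: pos_INR.
set E := Rpower _ _ => nE; have E0 : (0 < E)%R by apply: exp_pos.
apply: Rle_ge; apply: (Rmult_le_reg_r E) => //.
by rewrite /Rdiv Rmult_assoc Rinv_l ?Rmult_1_r //; apply: Rgt_not_eq.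
Qed.

(* p(M) <= 1/2  is written  2 * |M| <= n * n . *)
Theorem theorem4p2 :
  exists c : R, (0 < c)%R /\
    forall (n r : nat) (M : 'M[bool]_n),
      (0 < r)%N ->
      (bool_rank M <= r)%N ->
      (2 * ones M <= n * n)%N ->
      (INR (zM M) >= INR n / Rpower 2 (c * sqrt (INR r)))%R.
Proof.
(* 769 is the least L above 768. *)
exists (INR (24 * 769)); split; first by apply: lt_0_INR; apply/ssrnat.ltP.
by move=> n r M; apply: zM_Rpower.
Qed.
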